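(* In TX10, for every closed statement $s$ with $\mathsf{isSync}(s)$ and every global heap $g$, $\langle\{\mathtt{skip}\ s\},g\rangle\equiv\langle s,g\rangle$, where $\equiv$ is weak bisimilarity.
   Context: **Syntax.** $\mathsf{Pl}=\{0,\dots,n-1\}$ is a finite set of places (ranged over by $p,q$). $\mathsf{ObjId}$ is an infinite set of object ids with a fixed bijection with $\mathbb N$ (the enumeration order); $\mathsf p:\mathsf{ObjId}\to\mathsf{Pl}$ gives the home place; $\mathsf{ObjId}_q=\{o:\mathsf p(o)=q\}$; global references are $\mathsf{grObjId}=\{o\$p : o\in\mathsf{ObjId}_p\}$. Values $v$: object ids $o$, global references $o\$p$, exception constants $\mathsf E,\mathsf{BF},\mathsf{BG},\mathsf{DP}$. Expressions: $e::= v\mid x\mid e.f\mid\{f_1{:}e_1,\dots,f_n{:}e_n\}\mid \mathtt{globalref}\ e\mid\mathtt{valof}\ e$. Statements: $s,t::=\mathtt{skip}\mid\mathtt{throw}\ v$ ($v$ an exception constant) $\mid \mathtt{val}\ x=e\ s\mid e.f=e'\mid\{s\ t\}\mid\mathtt{at}(p)(\mathtt{val}\ x=e)\,s\mid\mathtt{async}\ s\mid\mathtt{finish}\ s\mid\mathtt{try}\ s\ \mathtt{catch}\ t$, plus the dynamic (runtime only) statements $\overline{\mathtt{at}}(p)\,s\mid\overline{\mathtt{async}}\,s\mid\mathtt{finish}_\mu\,s$ with $\mu$ a finite set of exception values; $\mathtt{finish}\ s$ abbreviates $\mathtt{finish}_\emptyset\,s$. In $\mathtt{val}\ x=e\ s$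 and $\mathtt{at}(p)(\mathtt{val}\ x=e)s$ the only free variable of $s$ is $x$. A configuration is closed if its statement has no free variables. **Heaps.** A local heap $h$ is a finite partial map from object ids to objects, an object being a finite partial map from field names to values. In TX10 a global heap $g$ maps every place of $\mathsf{Pl}$ to a local heap. $f[a\mapsto b]$ denotes map update. For $o\in\mathrm{dom}(h)$, $h_o$ is the set of object ids (local or global) reachable from $o$ in $h$ via fields. $g$ is place-local if for every $q\in\mathrm{dom}(g)$, with $h=g(q)$: $\mathrm{dom}(h)\subseteq\mathsf{ObjId}_q$ and $h_o\subseteq(\mathsf{ObjId}_q\cap\mathrm{dom}(h))\cup\mathsf{grObjId}$ for all $o\in\mathrm{dom}(h)$. **Predicates.** $\mathsf{isAsync}(\overline{\mathtt{async}}\,s)$; $\mathsf{isAsync}(s)$ implies $\mathsf{isAsync}(\overline{\mathtt{at}}(p)s)$ and $\mathsf{isAsync}(\mathtt{try}\,s\,\mathtt{catch}\,t)$; $\mathsf{isAsync}(s)$ and $\mathsf{isAsync}(t)$ imply $\mathsf{isAsync}(\{s\ t\})$. $\mathsf{isSync}$ holds of $\mathtt{skip}$, $\mathtt{val}\ x=e\ s$, $e.f=e'$, $\mathtt{at}(p)(\mathtt{val}\ x=e)s$, $\mathtt{async}\ s$, $\mathtt{finish}_\mu\,s$, $\mathtt{throw}\ v$; and $\mathsf{isSync}(s)$ implies $\mathsf{isSync}$ of $\{s\ t\}$, $\{t\ s\}$, $\overline{\mathtt{at}}(p)s$, $\mathtt{try}\,s\,\mathtt{catch}\,t$. **Transitions.**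 Configurations $k$ are $\langle s,g\rangle$ or $g$ (terminated). Labels $\lambda$: $\epsilon$ (normal), $v\otimes$ (synchronous exception), $v\times$ (asynchronous exception). $\to_p$ means $\xrightarrow{\epsilon}_p$. In rules, ''$A\mid B$'' in premise and conclusion denotes two rules, matching first with first and second with second. *Expressions* (at place $p$, local heap $h$): $\langle\{f_1{:}v_1,\dots,f_n{:}v_n\},h\rangle\to_p\langle o,h[o\mapsto\{f_i\mapsto v_i\}]\rangle$ with $o\in\mathsf{ObjId}_p\setminus\mathrm{dom}(h)$; $\langle o.f,h\rangle\to_p\langle v,h\rangle$ if $h(o)(f)=v$; $\langle o.f,h\rangle\xrightarrow{\mathsf{BF}\otimes}_p h$ if $f\notin\mathrm{dom}(h(o))$; $\langle\mathtt{globalref}\ o,h\rangle\to_p\langle o\$p,h\rangle$; $\langle\mathtt{valof}\ o\$p,h\rangle\to_p\langle o,h\rangle$; $\langle\mathtt{valof}\ v,h\rangle\xrightarrow{\mathsf{BG}\otimes}_p h$ if $v$ is not of the form $o\$p$; and if $\langle e,h\rangle\xrightarrow{\lambda}_p\langle e',h'\rangle\mid h$ then the same label is taken in the contexts $[\,].f$, $\mathtt{globalref}\,[\,]$, $\mathtt{valof}\,[\,]$, $\{f_1{:}v_1,\dots,f_i{:}v_i,f_{i+1}{:}[\,],\dots\}$ (leading to $h$ in the exceptional case). *Basic statements* (all require $p\in\mathrm{dom}(g)$): $\langle\mathtt{skip},g\rangle\to_p g$; $\langle\mathtt{throw}\ v,g\rangle\xrightarrow{v\otimes}_p g$; if $\langle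 s[v/x],g\rangle\xrightarrow{\lambda}_p\langle s',g'\rangle\mid g'$ then $\langle\mathtt{val}\ x=v\ s,g\rangle\xrightarrow{\lambda}_p\langle s',g'\rangle\mid g'$; $\langle o.f=v,g\rangle\to_p g[p\mapsto g(p)[o\mapsto g(p)(o)[f\mapsto v]]]$ if $f\in\mathrm{dom}(g(p)(o))$; $\langle o.f=v,g\rangle\xrightarrow{\mathsf{BF}\otimes}_p g$ if $f\notin\mathrm{dom}(g(p)(o))$; (Ctx) if $\langle e,g(p)\rangle\xrightarrow{\lambda}_p\langle e',h'\rangle\mid h'$ and $g'=g[p\mapsto h']$ then $\mathtt{val}\ x=e\ s$, $e.f=e_1$, $o.f=e$, $\mathtt{at}(q)(\mathtt{val}\ x=e)s$ in heap $g$ make a $\lambda$-step at $p$ to the same statement with $e'$ for $e$ in heap $g'$, resp. to $g'$. *Copy.* For $o\in\mathsf{ObjId}$ and $q\in\mathrm{dom}(g)$, $\mathsf{copy}(o,q,g)=(o',g[q\mapsto h'])$ where $h'$ extends $h=g(q)$ by a fresh isomorphic copy, rooted at $o'$, of the object graph reachable from $o$ in $g(\mathsf p(o))$; the new ids are the next unused elements of $\mathsf{ObjId}_q$ and global references are preserved unchanged. For other values $\mathsf{copy}(v,q,g)=(v,g)$. *Remaining TX10 rules:* (Spawn) $\langle\mathtt{async}\ s,g\rangle\to_p\langle\overline{\mathtt{async}}\,s,g\rangle$. (Async) if $\langle s,g\rangle\xrightarrow{\lambda}_p\langle s',g'\rangle\mid g'$ then $\langle\overline{\mathtt{async}}\,s,g\rangle\xrightarrow{\lambda'}_p\langle\overline{\mathtt{async}}\,s',g'\rangle\mid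 g'$, with $\lambda'=\epsilon$ if $\lambda=\epsilon$ and $\lambda'=v\times$ if $\lambda\in\{v\times,v\otimes\}$. (Finish) if $\langle s,g\rangle\xrightarrow{\lambda}_p\langle s',g'\rangle$ then $\langle\mathtt{finish}_\mu s,g\rangle\to_p\langle\mathtt{finish}_{\mu\cup\lambda}s',g'\rangle$, where $\mu\cup\epsilon=\mu$ and $\mu\cup v\times=\mu\cup v\otimes=\mu\cup\{v\}$. (End of Finish) if $\langle s,g\rangle\xrightarrow{\lambda}_p g'$ then $\langle\mathtt{finish}_\mu s,g\rangle\xrightarrow{\lambda'}_p g'$ with $\lambda'=\epsilon$ if $\mu\cup\lambda=\emptyset$, else $\lambda'=\mathsf E\otimes$. (Seq) if $\langle s,g\rangle\xrightarrow{\lambda}_p\langle s',g'\rangle\mid g'$: if $\lambda\in\{\epsilon,v\times\}$, $\langle\{s\ t\},g\rangle\xrightarrow{\lambda}_p\langle\{s'\ t\},g'\rangle\mid\langle t,g'\rangle$; if $\lambda=v\otimes$, $\langle\{s\ t\},g\rangle\xrightarrow{\lambda}_p\langle s',g'\rangle\mid g'$. (Par) if $\mathsf{isAsync}(t)$ and $\langle s,g\rangle\xrightarrow{\lambda}_p\langle s',g'\rangle\mid g'$ then $\langle\{t\ s\},g\rangle\xrightarrow{\lambda}_p\langle\{t\ s'\},g'\rangle\mid\langle t,g'\rangle$. (Place Shift) if $(v',g')=\mathsf{copy}(v,q,g)$ then $\langle\mathtt{at}(q)(\mathtt{val}\ x=v)s,g\rangle\to_p\langle\overline{\mathtt{at}}(q)\{s[v'/x]\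 \mathtt{skip}\},g'\rangle$. (At) if $\langle s,g\rangle\xrightarrow{\lambda}_q\langle s',g'\rangle\mid g'$ then $\langle\overline{\mathtt{at}}(q)s,g\rangle\xrightarrow{\lambda}_p\langle\overline{\mathtt{at}}(q)s',g'\rangle\mid g'$. (Try) if $\langle s,g\rangle\xrightarrow{\lambda}_p\langle s',g'\rangle\mid g'$: if $\lambda\in\{\epsilon,v\times\}$, $\langle\mathtt{try}\,s\,\mathtt{catch}\,t,g\rangle\xrightarrow{\lambda}_p\langle\mathtt{try}\,s'\,\mathtt{catch}\,t,g'\rangle\mid g'$; if $\lambda=v\otimes$, $\langle\mathtt{try}\,s\,\mathtt{catch}\,t,g\rangle\to_p\langle\{s'\ t\},g'\rangle\mid\langle t,g'\rangle$. **Weak bisimulation.** An environment move is a map $\Phi$ on global heaps such that $\Phi(g)$ is place-local whenever $g$ is, $\mathrm{dom}(\Phi(g))=\mathrm{dom}(g)$, and $\mathrm{dom}(g(p))\subseteq\mathrm{dom}(\Phi(g)(p))$ for all $p\in\mathrm{dom}(g)$. $\overset{\lambda}{\Longrightarrow}_p$ is $(\to_p)^*\xrightarrow{\lambda}_p(\to_p)^*$ if $\lambda\neq\epsilon$, and $(\to_p)^*$ if $\lambda=\epsilon$. A binary relation $\mathcal R$ on closed configurations is a weak bisimulation if: (1) $g\,\mathcal R\,k$ implies $k=g$; (2) $\langle s,g\rangle\,\mathcal R\,k$ implies $k=\langle t,g\rangle$ for some $t$, $\mathsf{isSync}(s)$ iff $\mathsf{isSync}(t)$, and for every environment move $\Phi$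 and every place $p$: (a) if $\langle s,\Phi(g)\rangle\xrightarrow{\lambda}_p\langle s',g'\rangle$ then for some $t'$, $\langle t,\Phi(g)\rangle\overset{\lambda}{\Longrightarrow}_p\langle t',g'\rangle$ and $\langle s',g'\rangle\,\mathcal R\,\langle t',g'\rangle$, and vice versa; (b) if $\langle s,\Phi(g)\rangle\xrightarrow{\lambda}_p g'$ then $\langle t,\Phi(g)\rangle\overset{\lambda}{\Longrightarrow}_p g'$, and vice versa. Weak bisimilarity $\equiv$ is the largest weak bisimulation. *)

(* Defs.v *)
From Stdlib Require Import Relation_Operators.
From HB Require Import structures.
From mathcomp Require Import all_boot.
From mathcomp Require Import finmap.

Set Implicit Arguments.
Unset Strict Implicit.
Unset Printing Implicit Defensive.

Local Open Scope fset_scope.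
Local Open Scope fmap_scope.

(* Object ids are identified with their positions in the enumeration order. *)
Notation ObjId := nat (only parsing).

(* The exception constants E, BF, BG, DP. *)
Inductive exn := ExE | ExBF | ExBG | ExDP.

Definition exn_code (v : exn) : 'I_4 :=
  match v with
  | ExE => inord 0 | ExBF => inord 1 | ExBG => inord 2 | ExDP => inord 3
  end.

Definition exn_decode (i : 'I_4) : option exn :=
  nth None [:: Some ExE; Some ExBF; Some ExBG; Some ExDP] i.

Lemma exn_codeK : pcancel exn_code exn_decode.
Proof. by case; rewrite /exn_decode /exn_code inordK. Qed.

HB.instance Definition _ := Finite.copy exn (pcan_type exn_codeK).

(* [VGref o] is the global reference o$p where p is the home place of o: as
   grObjId only contains o$p with o in ObjId_p, the place is determined by o. *)
Inductive value :=
  | VObj of ObjId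
  | VGref of ObjId
  | VExn of exn.

Inductive label :=
  | Eps
  | Sync of exn
  | Async of exn.

(* lab_join mu l is mu \cup l, with an epsilon label contributing nothing. *)
Definition lab_join (mu : {set exn}) (l : label) : {set exn} :=
  match l with
  | Eps => mu
  | Sync v | Async v => v |: mu
  end.

Definition lab_async (l : label) : label :=
  match l with
  | Eps => Eps
  | Sync v | Async v => Async v
  end.

Definition is_sync_label (l : label) : bool :=
  if l is Sync _ then true else false.

(* Configurations <s, g> and g; used for expressions with a local heap and for
   statements with a global heap. *)
Inductive config (A H : Type) :=
  | Run of A & H
  | Term of H.
Arguments Run {A H}.
Arguments Term {A H}.

(* The result "<C[s'], g'> | g'" obtained from "<s', g'> | g'". *)
Definition in_ctx (A B H : Type) (C : A -> B) (k : config A H) : config B H :=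
  match k with
  | Run s h => Run (C s) h
  | Term h => Term h
  end.

(* The result "<C[s'], g'> | <t, g'>" obtained from "<s', g'> | g'". *)
Definition in_ctx_or (A H : Type) (C : A -> A) (t : A) (k : config A H) :
    config A H :=
  match k with
  | Run s h => Run (C s) h
  | Term h => Run t h
  end.

Section TX10.

(* n places, home place of each object id, field names and variables. *)
Context (n : nat) (home : ObjId -> 'I_n) (Fld Var : choiceType).

Inductive expr :=
  | EVal of value
  | EVar of Var
  | EGet of expr & Fld                            (* e.f *)
  | ENew of seq (Fld * expr)                      (* {f1:e1, ..., fn:en} *)
  | EGlobalref of expr
  | EValof of expr.

Inductive stmt :=
  | SSkip
  | SThrow of exn
  | SVal of Var & expr & stmt                     (* val x = e s *)
  | SAssign of expr & Fld & expr                  (* e.f = e' *)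
  | SSeq of stmt & stmt                           (* {s t} *)
  | SAt of 'I_n & Var & expr & stmt               (* at(p)(val x = e) s *)
  | SAsync of stmt
  | SFinish of {set exn} & stmt                   (* finish_mu s *)
  | STry of stmt & stmt
  | SDynAt of 'I_n & stmt                         (* overlined at(p) s *)
  | SDynAsync of stmt.                            (* overlined async s *)

Fixpoint fv_expr (e : expr) : {fset Var} :=
  match e with
  | EVal _ => fset0
  | EVar x => [fset x]
  | EGet e1 _ | EGlobalref e1 | EValof e1 => fv_expr e1
  | ENew fes => foldr (fun fe acc => fv_expr fe.2 `|` acc) fset0 fes
  end.

Fixpoint fv (s : stmt) : {fset Var} :=
  match s with
  | SSkip | SThrow _ => fset0
  | SVal x e s1 | SAt _ x e s1 => fv_expr e `|` (fv s1 `\ x)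
  | SAssign e _ e' => fv_expr e `|` fv_expr e'
  | SSeq s1 s2 | STry s1 s2 => fv s1 `|` fv s2
  | SAsync s1 | SFinish _ s1 | SDynAt _ s1 | SDynAsync s1 => fv s1
  end.

(* The side conditions of the grammar: the field names of an object literal are
   pairwise distinct, and in val x = e s and at(p)(val x = e) s only x may be
   free in s. *)
Fixpoint wf_expr (e : expr) : bool :=
  match e with
  | EVal _ | EVar _ => true
  | EGet e1 _ | EGlobalref e1 | EValof e1 => wf_expr e1
  | ENew fes => uniq (map fst fes) && all (fun fe => wf_expr fe.2) fes
  end.

Fixpoint wf_stmt (s : stmt) : bool :=
  match s with
  | SSkip | SThrow _ => true
  | SVal x e s1 | SAt _ x e s1 =>
      [&& wf_expr e, wf_stmt s1 & fv s1 `<=` [fset x]]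
  | SAssign e _ e' => wf_expr e && wf_expr e'
  | SSeq s1 s2 | STry s1 s2 => wf_stmt s1 && wf_stmt s2
  | SAsync s1 | SFinish _ s1 | SDynAt _ s1 | SDynAsync s1 => wf_stmt s1
  end.

Definition closed_stmt (s : stmt) : Prop := fv s = fset0.

(* Substitution of a value (hence a closed term) for a variable. *)
Fixpoint subst_expr (v : value) (x : Var) (e : expr) : expr :=
  match e with
  | EVal w => EVal w
  | EVar y => if y == x then EVal v else EVar y
  | EGet e1 f => EGet (subst_expr v x e1) f
  | ENew fes => ENew (map (fun fe => (fe.1, subst_expr v x fe.2)) fes)
  | EGlobalref e1 => EGlobalref (subst_expr v x e1)
  | EValof e1 => EValof (subst_expr v x e1)
  end.

Fixpoint subst (v : value) (x : Var) (s : stmt) : stmt :=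
  match s with
  | SSkip => SSkip
  | SThrow w => SThrow w
  | SVal y e s1 =>
      SVal y (subst_expr v x e) (if y == x then s1 else subst v x s1)
  | SAssign e f e' => SAssign (subst_expr v x e) f (subst_expr v x e')
  | SSeq s1 s2 => SSeq (subst v x s1) (subst v x s2)
  | SAt p y e s1 =>
      SAt p y (subst_expr v x e) (if y == x then s1 else subst v x s1)
  | SAsync s1 => SAsync (subst v x s1)
  | SFinish mu s1 => SFinish mu (subst v x s1)
  | STry s1 s2 => STry (subst v x s1) (subst v x s2)
  | SDynAt p s1 => SDynAt p (subst v x s1)
  | SDynAsync s1 => SDynAsync (subst v x s1)
  end.

Inductive isAsync : stmt -> Prop :=
  | isAsync_async s : isAsync (SDynAsync s)
  | isAsync_at p s : isAsync s -> isAsync (SDynAt p s)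
  | isAsync_try s t : isAsync s -> isAsync (STry s t)
  | isAsync_seq s t : isAsync s -> isAsync t -> isAsync (SSeq s t).

Inductive isSync : stmt -> Prop :=
  | isSync_skip : isSync SSkip
  | isSync_val x e s : isSync (SVal x e s)
  | isSync_assign e f e' : isSync (SAssign e f e')
  | isSync_place_shift p x e s : isSync (SAt p x e s)
  | isSync_async s : isSync (SAsync s)
  | isSync_finish mu s : isSync (SFinish mu s)
  | isSync_throw v : isSync (SThrow v)
  | isSync_seql s t : isSync s -> isSync (SSeq s t)
  | isSync_seqr s t : isSync s -> isSync (SSeq t s)
  | isSync_at p s : isSync s -> isSync (SDynAt p s)
  | isSync_try s t : isSync s -> isSync (STry s t).

Definition object := {fmap Fld -> value}.
Definition lheap := {fmap ObjId -> object}.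

(* Global heaps are total on the places, so dom(g) is always the set of all
   places and premises of the form p \in dom(g) are void. *)
Definition gheap := {ffun 'I_n -> lheap}.

Definition upd (g : gheap) (p : 'I_n) (h : lheap) : gheap :=
  [ffun q => if q == p then h else g q].

Definition mk_object (fvs : seq (Fld * value)) : object :=
  foldr (fun fv (ob : object) => ob.[fv.1 <- fv.2]) [fmap] fvs.

Definition is_ref (v : value) : bool :=
  if v is VExn _ then false else true.

(* reach h o v: v is an object id or global reference reachable from o in h
   (o included); global references are not followed. *)
Inductive reach (h : lheap) (o : ObjId) : value -> Prop :=
  | reach_root : reach h o (VObj o)
  | reach_field o1 (ob : object) f v :
      reach h o (VObj o1) -> h.[? o1] = Some ob -> ob.[? f] = Some v ->
      is_ref v -> reach h o v.

Definition place_local (g : gheap) : Prop :=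
  forall (q : 'I_n) (o : ObjId), o \in domf (g q) ->
    home o = q /\
    forall v, reach (g q) o v ->
      match v with
      | VObj o1 => home o1 = q /\ o1 \in domf (g q)
      | VGref _ => True
      | VExn _ => False
      end.

Definition rename_value (rho : ObjId -> ObjId) (v : value) : value :=
  if v is VObj o then VObj (rho o) else v.

Definition rename_object (rho : ObjId -> ObjId) (ob : object) : object :=
  [fmap f : domf ob => rename_value rho (ob f)].

(* copies v q g v' g' is the graph of the function copy(v, q, g) = (v', g').
   The k ids reachable from the root are sent, in increasing order, to the
   first k elements of ObjId_q not in dom(g(q)). The function is undefined
   when an id reachable from the root is not allocated. *)
Inductive copies (q : 'I_n) (g : gheap) : value -> value -> gheap -> Prop :=
  | copies_obj (o : ObjId) (rho : ObjId -> ObjId) (h' : lheap) :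
      let src := g (home o) in
      let h := g q in
      let D o1 := reach src o (VObj o1) in
      (forall o1, D o1 -> o1 \in domf src) ->
      (forall o1, D o1 -> home (rho o1) = q /\ rho o1 \notin domf h) ->
      (forall o1 o2, D o1 -> D o2 -> o1 < o2 -> rho o1 < rho o2) ->
      (forall o1 m, D o1 -> m < rho o1 -> home m = q -> m \notin domf h ->
         exists2 o2, D o2 & rho o2 = m) ->
      (forall o1, D o1 -> h'.[? rho o1] = omap (rename_object rho) src.[? o1]) ->
      (forall m, (forall o1, D o1 -> rho o1 <> m) -> h'.[? m] = h.[? m]) ->
      copies q g (VObj o) (VObj (rho o)) (upd g q h')
  | copies_gref o : copies q g (VGref o) (VGref o) g
  | copies_exn e : copies q g (VExn e) (VExn e) g.

(* Evaluation contexts {f1:v1, ..., fi:vi, f:[], ...}. *)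
Definition new_ctx (pre : seq (Fld * value)) (f : Fld)
    (post : seq (Fld * expr)) (e : expr) : expr :=
  ENew ([seq (fv.1, EVal fv.2) | fv <- pre] ++ (f, e) :: post).

(* estep p e h l k is  <e, h> --l-->_p k. *)
Inductive estep (p : 'I_n) : expr -> lheap -> label -> config expr lheap -> Prop :=
  | E_new fvs h o :
      home o = p -> o \notin domf h ->
      estep p (ENew [seq (fv.1, EVal fv.2) | fv <- fvs]) h Eps
        (Run (EVal (VObj o)) h.[o <- mk_object fvs])
  | E_get o f (h : lheap) (ob : object) v :
      h.[? o] = Some ob -> ob.[? f] = Some v ->
      estep p (EGet (EVal (VObj o)) f) h Eps (Run (EVal v) h)
  | E_get_bad o f (h : lheap) (ob : object) :
      h.[? o] = Some ob -> f \notin domf ob ->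
      estep p (EGet (EVal (VObj o)) f) h (Sync ExBF) (Term h)
  | E_globalref o h :
      home o = p ->
      estep p (EGlobalref (EVal (VObj o))) h Eps (Run (EVal (VGref o)) h)
  | E_valof o h :
      home o = p ->
      estep p (EValof (EVal (VGref o))) h Eps (Run (EVal (VObj o)) h)
  | E_valof_bad v h :
      (forall o, home o = p -> v <> VGref o) ->
      estep p (EValof (EVal v)) h (Sync ExBG) (Term h)
  | E_ctx_get e f h l k :
      estep p e h l k ->
      estep p (EGet e f) h l (in_ctx (fun e' => EGet e' f) k)
  | E_ctx_globalref e h l k :
      estep p e h l k ->
      estep p (EGlobalref e) h l (in_ctx EGlobalref k)
  | E_ctx_valof e h l k :
      estep p e h l k ->
      estep p (EValof e) h l (in_ctx EValof k)
  | E_ctx_new pre f post e h l k :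
      estep p e h l k ->
      estep p (new_ctx pre f post e) h l (in_ctx (new_ctx pre f post) k).

Definition sconfig := config stmt gheap.

(* The result of rule (Ctx): C is the statement context around the evaluated
   expression. *)
Definition lift_config (g : gheap) (p : 'I_n) (C : expr -> stmt)
    (k : config expr lheap) : sconfig :=
  match k with
  | Run e' h' => Run (C e') (upd g p h')
  | Term h' => Term (upd g p h')
  end.

(* The contexts of rule (Ctx). *)
Inductive expr_ctx : (expr -> stmt) -> Prop :=
  | ctx_val x s : expr_ctx (fun e => SVal x e s)
  | ctx_target f e1 : expr_ctx (fun e => SAssign e f e1)
  | ctx_source o f : expr_ctx (fun e => SAssign (EVal (VObj o)) f e)
  | ctx_at q x s : expr_ctx (fun e => SAt q x e s).

(* step p k l k' is  k --l-->_p k'; only running configurations step. *)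
Inductive step : 'I_n -> sconfig -> label -> sconfig -> Prop :=
  | S_skip p g : step p (Run SSkip g) Eps (Term g)
  | S_throw p v g : step p (Run (SThrow v) g) (Sync v) (Term g)
  | S_val p x v s g l k :
      step p (Run (subst v x s) g) l k ->
      step p (Run (SVal x (EVal v) s) g) l k
  | S_assign p o f v (g : gheap) (ob : object) :
      (g p).[? o] = Some ob -> f \in domf ob ->
      step p (Run (SAssign (EVal (VObj o)) f (EVal v)) g) Eps
        (Term (upd g p (g p).[o <- ob.[f <- v]]))
  | S_assign_bad p o f v (g : gheap) (ob : object) :
      (g p).[? o] = Some ob -> f \notin domf ob ->
      step p (Run (SAssign (EVal (VObj o)) f (EVal v)) g) (Sync ExBF) (Term g)
  | S_ctx p C e (g : gheap) l k :
      expr_ctx C -> estep p e (g p) l k ->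
      step p (Run (C e) g) l (lift_config g p C k)
  | S_spawn p s g : step p (Run (SAsync s) g) Eps (Run (SDynAsync s) g)
  | S_async p s g l k :
      step p (Run s g) l k ->
      step p (Run (SDynAsync s) g) (lab_async l) (in_ctx SDynAsync k)
  | S_finish p mu s g l s' g' :
      step p (Run s g) l (Run s' g') ->
      step p (Run (SFinish mu s) g) Eps (Run (SFinish (lab_join mu l) s') g')
  | S_end_finish p mu s g l g' :
      step p (Run s g) l (Term g') ->
      step p (Run (SFinish mu s) g)
        (if lab_join mu l == set0 then Eps else Sync ExE) (Term g')
  | S_seq p s t g l k :
      step p (Run s g) l k -> ~~ is_sync_label l ->
      step p (Run (SSeq s t) g) l (in_ctx_or (fun s' => SSeq s' t) t k)
  | S_seq_exn p s t g v k :
      step p (Run s g) (Sync v) k ->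
      step p (Run (SSeq s t) g) (Sync v) k
  | S_par p s t g l k :
      isAsync t -> step p (Run s g) l k ->
      step p (Run (SSeq t s) g) l (in_ctx_or (fun s' => SSeq t s') t k)
  | S_place_shift p q x v s g v' g' :
      copies q g v v' g' ->
      step p (Run (SAt q x (EVal v) s) g) Eps
        (Run (SDynAt q (SSeq (subst v' x s) SSkip)) g')
  | S_at p q s g l k :
      step q (Run s g) l k ->
      step p (Run (SDynAt q s) g) l (in_ctx (SDynAt q) k)
  | S_try p s t g l k :
      step p (Run s g) l k -> ~~ is_sync_label l ->
      step p (Run (STry s t) g) l (in_ctx (fun s' => STry s' t) k)
  | S_try_exn p s t g v k :
      step p (Run s g) (Sync v) k ->
      step p (Run (STry s t) g) Eps (in_ctx_or (fun s' => SSeq s' t) t k).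

Definition eps_steps (p : 'I_n) : sconfig -> sconfig -> Prop :=
  clos_refl_trans sconfig (fun k k' => step p k Eps k').

Definition weak_step (p : 'I_n) (k : sconfig) (l : label) (k' : sconfig) : Prop :=
  if l is Eps then eps_steps p k k'
  else exists k1 k2, [/\ eps_steps p k k1, step p k1 l k2 & eps_steps p k2 k'].

(* dom(Phi(g)) = dom(g) holds by totality of global heaps. *)
Definition env_move (Phi : gheap -> gheap) : Prop :=
  (forall g, place_local g -> place_local (Phi g)) /\
  (forall (g : gheap) (p : 'I_n), domf (g p) `<=` domf (Phi g p)).

Definition closed_config (k : sconfig) : Prop :=
  match k with
  | Run s _ => wf_stmt s /\ closed_stmt s
  | Term _ => True
  end.

Definition weak_bisimulation (R : sconfig -> sconfig -> Prop) : Prop :=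
  [/\ forall k1 k2, R k1 k2 -> closed_config k1 /\ closed_config k2,
      forall g k, R (Term g) k -> k = Term g
    & forall s g k, R (Run s g) k ->
        exists t, [/\ k = Run t g, isSync s <-> isSync t &
          forall Phi p l, env_move Phi ->
            [/\ forall s' g', step p (Run s (Phi g)) l (Run s' g') ->
                  exists2 t', weak_step p (Run t (Phi g)) l (Run t' g')
                            & R (Run s' g') (Run t' g'),
                forall t' g', step p (Run t (Phi g)) l (Run t' g') ->
                  exists2 s', weak_step p (Run s (Phi g)) l (Run s' g')
                            & R (Run s' g') (Run t' g'),
                forall g', step p (Run s (Phi g)) l (Term g') ->
                  weak_step p (Run t (Phi g)) l (Term g')
              & forall g', step p (Run t (Phi g)) l (Term g') ->
                  weak_step p (Run s (Phi g)) l (Term g')]]].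

(* The union of all weak bisimulations, which is itself the largest one. *)
Definition weak_bisimilar (k1 k2 : sconfig) : Prop :=
  exists2 R, weak_bisimulation R & R k1 k2.

Lemma weak_bisimulation_bisimilar : weak_bisimulation weak_bisimilar.
Proof.
split.
- by move=> k1 k2 [R [Rcl _ _]]; apply: Rcl.
- by move=> g k [R [_ Rt _]]; apply: Rt.
- move=> s g k [R RB]; case: (RB) => _ _ Rs /Rs [t [-> st H]].
  exists t; split=> // Phi p l /(H _ p l) [H1 H2 H3 H4]; split=> //.
  + by move=> s' g' /H1 [t' ? ?]; exists t' => //; exists R.
  + by move=> t' g' /H2 [s' ? ?]; exists s' => //; exists R.
Qed.

End TX10.

Arguments SSkip {n Fld Var}.
Arguments SThrow {n Fld Var}.
Arguments EVal {Fld Var}.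
Arguments EVar {Fld Var}.

(* Main.v *)
Require Import Defs.
From mathcomp Require Import all_boot.
From mathcomp Require Import finmap.
From Stdlib Require Import Relation_Operators.

Set Implicit Arguments.
Unset Strict Implicit.
Unset Printing Implicit Defensive.

Local Open Scope fset_scope.

(** The pairs [({skip s}, s)] together with the identity form a weak
    bisimulation: as [skip] is not asynchronous, the only move of [{skip s}] is
    the silent step to [s] in an unchanged heap, which [s] matches by not moving
    and which is also the prefix needed to match the moves of [s].
    Synchronicity of [s] is what makes the two related statements agree on
    [isSync], since [{skip s}] is always synchronous. Bisimulations live on
    closed configurations, so the identity part needs subject reduction. *)

Section SkipSeq.

Context (n : nat) (home : nat -> 'I_n) (Fld Var : choiceType).

Local Notation expr := (expr Fld Var).
Local Notation stmt := (stmt n Fld Var).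
Local Notation gheap := (gheap n Fld).
Local Notation step := (@step n home Fld Var).

(** * Substitution of values: free variables and well-formedness *)

(* The principle generated by Rocq gives no hypothesis on the fields of [ENew]. *)
Lemma expr_nested_ind (P : expr -> Prop) :
  (forall v, P (EVal v)) -> (forall x, P (EVar x)) ->
  (forall e f, P e -> P (EGet e f)) ->
  (forall fes, foldr (fun fe acc => P fe.2 /\ acc) True fes -> P (ENew fes)) ->
  (forall e, P e -> P (EGlobalref e)) -> (forall e, P e -> P (EValof e)) ->
  forall e, P e.
Proof.
move=> Pval Pvar Pget Pnew Pref Pof; fix IH 1; case.
- exact: Pval.
- exact: Pvar.
- by move=> e f; apply: Pget.
(* The inner induction on the list becomes a nested fixpoint, so that [IH] is only called on the
   subterms [fe.2] and the guard condition holds. *)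
- by move=> fes; apply: Pnew; elim: fes => [|fe fes IHfes] //=; split.
- by move=> e; apply: Pref.
- by move=> e; apply: Pof.
Qed.

(** A value has no free variables, so substituting it only removes [x]. *)
Lemma fv_subst_expr v x (e : expr) :
  fv_expr (subst_expr v x e) = fv_expr e `\ x.
Proof.
elim/expr_nested_ind: e => //=.
- by move=> w; rewrite fset0D.
- move=> y; case: eqP => [->|/eqP xy] /=; apply/fsetP => z; rewrite !inE.
    by case: (z == x).
  by case: (z =P y) => [->|]; rewrite ?xy ?andbF.
- elim=> [|fe fes IH] /=; first by rewrite fset0D.
  by case=> -> /IH ->; rewrite fsetDUl.
Qed.

Lemma wf_subst_expr v x (e : expr) : wf_expr e -> wf_expr (subst_expr v x e).
Proof.
elim/expr_nested_ind: e => //=.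
- by move=> y _; case: eqP.
- move=> fes IH /andP[fes_uniq fes_wf]; apply/andP; split.
    by rewrite -map_comp (eq_map (g := fst)).
  elim: fes IH fes_wf {fes_uniq} => [|fe fes IHfes] //= [IHe IH] /andP[wfe wfs].
  by rewrite IHe //= IHfes.
Qed.

(** At a binder of [y], either [y] is [x], and the untouched body loses [x] to the binder anyway, or
    the two set differences commute. *)
Lemma fv_subst v x (s : stmt) : fv (subst v x s) = fv s `\ x.
Proof.
have bindE (y : Var) (e : expr) (s1 : stmt) : fv (subst v x s1) = fv s1 `\ x ->
  fv_expr (subst_expr v x e) `|` (fv (if y == x then s1 else subst v x s1) `\ y)
  = (fv_expr e `|` (fv s1 `\ y)) `\ x.
  rewrite fv_subst_expr fsetDUl => IH; congr (_ `|` _).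
  case: eqP => [->|_]; last by rewrite IH !fsetDDl fsetUC.
  by rewrite fsetDDl fsetUid.
elim: s => //=.
- by rewrite fset0D.
- by rewrite fset0D.
- by move=> e f e'; rewrite !fv_subst_expr fsetDUl.
- by move=> s1 -> s2 ->; rewrite fsetDUl.
- by move=> s1 -> s2 ->; rewrite fsetDUl.
Qed.

(** The side condition on binders survives because substitution can only shrink the set of free
    variables. *)
Lemma wf_subst v x (s : stmt) : wf_stmt s -> wf_stmt (subst v x s).
Proof.
have bind_wf (y : Var) (e : expr) (s1 : stmt) :
    (wf_stmt s1 -> wf_stmt (subst v x s1)) ->
    [&& wf_expr e, wf_stmt s1 & fv s1 `<=` [fset y]] ->
    let s2 := if y == x then s1 else subst v x s1 in
    [&& wf_expr (subst_expr v x e), wf_stmt s2 & fv s2 `<=` [fset y]].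
  move=> IH /and3P[wfe wfs fvs]; rewrite wf_subst_expr //=.
  case: eqP => _; first by rewrite wfs.
  by rewrite IH //= fv_subst (fsubset_trans _ fvs) ?fsubD1set.
elim: s => //=.
- by move=> e f e' /andP[? ?]; rewrite !wf_subst_expr.
- by move=> s1 IH1 s2 IH2 /andP[/IH1 -> /IH2].
- by move=> s1 IH1 s2 IH2 /andP[/IH1 -> /IH2].
Qed.

(** The grammar lets the body of a binder mention only the bound variable, so this covers the bodies
    opened by [S_val] and [S_place_shift]. *)
Lemma closed_wf_subst v x (s : stmt) :
  wf_stmt s -> fv s `<=` [fset x] ->
  wf_stmt (subst v x s) /\ closed_stmt (subst v x s).
Proof.
move=> wfs fvs; split; first exact: wf_subst.
by apply/eqP; rewrite fv_subst fsetD_eq0.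
Qed.

(** * Subject reduction: transitions preserve closed configurations *)

Lemma estep_wf_closed p (e : expr) h l k :
  estep home p e h l k ->
  wf_expr e /\ fv_expr e = fset0 ->
  if k is Run e' _ then wf_expr e' /\ fv_expr e' = fset0 else True.
Proof.
elim=> {e h l k} //=.
- by move=> e f h l [] //.
- by move=> e h l [] //.
- by move=> e h l [] //.
move=> pre f post e h l [e' h' | //] _ IH /=.
rewrite !map_cat /= !all_cat /= !foldr_cat /=.
(* The fields to the left of the hole are already values and contribute no free variables. *)
have fold_pre (A : {fset Var}) : foldr (fun fe acc => fv_expr fe.2 `|` acc) A
    [seq (fv.1, EVal fv.2) | fv <- pre] = A.
  by elim: pre => //= ? ? ->; rewrite fset0U.
rewrite !fold_pre => -[/and4P[-> -> wfe ->]] /eqP.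
rewrite fsetU_eq0 => /andP[/eqP fve /eqP ->].
by have [-> ->] := IH (conj wfe fve); rewrite fsetU0.
Qed.

Lemma closed_in_ctx (C : stmt -> stmt) (k : sconfig n Fld Var) :
  (forall s, wf_stmt s /\ closed_stmt s -> wf_stmt (C s) /\ closed_stmt (C s)) ->
  closed_config k -> closed_config (in_ctx C k).
Proof. by case: k => //= s g; apply. Qed.

Lemma closed_in_ctx_or (C : stmt -> stmt) t (k : sconfig n Fld Var) :
  (forall s, wf_stmt s /\ closed_stmt s -> wf_stmt (C s) /\ closed_stmt (C s)) ->
  wf_stmt t /\ closed_stmt t ->
  closed_config k -> closed_config (in_ctx_or C t k).
Proof. by case: k => //= s g HC _; apply: HC. Qed.

Lemma closed_seq (s t : stmt) :
  wf_stmt (SSeq s t) /\ closed_stmt (SSeq s t) <->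
  (wf_stmt s /\ closed_stmt s) /\ (wf_stmt t /\ closed_stmt t).
Proof.
rewrite /closed_stmt /=; split=> [[/andP[-> ->] /eqP]|[[-> ->] [-> ->]]].
  by rewrite fsetU_eq0 => /andP[/eqP -> /eqP ->].
by rewrite fsetU0.
Qed.

(** [STry] and [SSeq] have the same clauses in [wf_stmt] and [fv], so the two statements are
    convertible. *)
Lemma closed_try (s t : stmt) :
  wf_stmt (STry s t) /\ closed_stmt (STry s t) <->
  (wf_stmt s /\ closed_stmt s) /\ (wf_stmt t /\ closed_stmt t).
Proof. exact: (closed_seq s t). Qed.

(** In each of these contexts the hole lies outside the scope of the bound variable, so the
    expression in it is itself closed. *)
Lemma closed_lift_config (g : gheap) p C (e : expr) l k :
  expr_ctx (n := n) C -> estep home p e (g p) l k ->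
  closed_config (Run (C e) g) -> closed_config (lift_config g p C k).
Proof.
move=> Cctx /estep_wf_closed; case: k => [e' h'|//] ee'.
case: Cctx => [x s|f e1|o f|q x s] /=; rewrite /closed_stmt /=.
- case=> /and3P[wfe -> ->] /eqP; rewrite fsetU_eq0 => /andP[/eqP fve /eqP ->].
  by have [-> ->] := ee' (conj wfe fve); rewrite fsetU0.
- case=> /andP[wfe ->] /eqP; rewrite fsetU_eq0 => /andP[/eqP fve /eqP ->].
  by have [-> ->] := ee' (conj wfe fve); rewrite fsetU0.
- by rewrite !fset0U.
- case=> /and3P[wfe -> ->] /eqP; rewrite fsetU_eq0 => /andP[/eqP fve /eqP ->].
  by have [-> ->] := ee' (conj wfe fve); rewrite fsetU0.
Qed.

Lemma step_closed p k l k' :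
  step p k l k' -> closed_config k -> closed_config k'.
Proof.
elim=> {p k l k'} //.
- move=> p x v s g l k _ IH [/and3P[_ wfs fvs] _].
  by apply: IH; apply: closed_wf_subst.
- by move=> p C e g l k; apply: closed_lift_config.
- by move=> p s g l k _ IH /IH; apply: closed_in_ctx.
- move=> p s t g l k _ IH _ /closed_seq[/IH cs ct].
  by apply: closed_in_ctx_or => // s' cs'; apply/closed_seq.
- by move=> p s t g v k _ IH /closed_seq[/IH].
- move=> p s t g l k _ _ IH /closed_seq[ct /IH cs].
  by apply: closed_in_ctx_or => // s' cs'; apply/closed_seq.
- move=> p q x v s g v' g' _ [/and3P[_ wfs fvs] _].
  by apply/(closed_seq (subst v' x s) SSkip); split=> //; apply: closed_wf_subst.
- by move=> p q s g l k _ IH /IH; apply: closed_in_ctx.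
- move=> p s t g l k _ IH _ /closed_try[/IH cs ct].
  by apply: closed_in_ctx cs => s' cs'; apply/closed_try.
- move=> p s t g v k _ IH /closed_try[/IH cs ct].
  by apply: closed_in_ctx_or => // s' cs'; apply/closed_seq.
Qed.

(** * Transitions of [{skip s}] and weak transitions *)

Lemma step_skip_seq_inv p (s : stmt) g l k :
  step p (Run (SSeq SSkip s) g) l k -> l = Eps /\ k = Run s g.
Proof.
have skip_inv p1 g1 l1 k1 :
    step p1 (Run SSkip g1) l1 k1 -> l1 = Eps /\ k1 = Term g1.
  move E: (Run _ _) => k0 st; case: st E => //; first by move=> ? ? [->].
  (* In rule [S_ctx] the source is [C e] with [C] abstract; listing the possible contexts shows that
     none of them builds [skip]. *)
  by move=> ? C e ? ? ? [].
move E: (Run _ _) => k0 st; case: st E => //.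
- by move=> ? C e ? ? ? [].
- move=> p1 s1 t1 g1 l1 k1 st _ [E1 E2 E3]; move: st.
  by rewrite -E1 -E2 => /skip_inv[-> ->]; rewrite -E3.
(* [S_seq_exn] would need a synchronous exception from [skip], whose only label is [Eps]. *)
- move=> p1 s1 t1 g1 v k1 st [E1 _ _]; move: st.
  by rewrite -E1 => /skip_inv[].
- move=> p1 s1 t1 g1 l1 k1 t1_async _ [E1 _ _].
  by rewrite -E1 in t1_async; inversion t1_async.
Qed.

Lemma step_skip_seq p (s : stmt) g : step p (Run (SSeq SSkip s) g) Eps (Run s g).
Proof. exact: (S_seq s (S_skip home Var p g) isT). Qed.

Lemma weak_step1 p (k : sconfig n Fld Var) l k' :
  step p k l k' -> weak_step home p k l k'.
Proof.
case: l => [|v|v] st; first exact: rt_step.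
all: by exists k, k'; split=> //; apply: rt_refl.
Qed.

(** The silent step is absorbed by the initial silent phase, which for label [Eps] is the whole weak
    transition. *)
Lemma weak_step_prepend p (k1 k2 : sconfig n Fld Var) l k3 :
  step p k1 Eps k2 -> weak_step home p k2 l k3 -> weak_step home p k1 l k3.
Proof.
move=> st; have k12 : eps_steps home p k1 k2 by apply: rt_step.
case: l => [|v|v] /=; first exact: rt_trans k12.
all: case=> k [k' [k2k kk' k'k3]]; exists k, k'; split=> //.
all: exact: rt_trans k12 k2k.
Qed.

(** * The bisimulation *)

Inductive skip_seq_rel : sconfig n Fld Var -> sconfig n Fld Var -> Prop :=
  | skip_seq_refl k : closed_config k -> skip_seq_rel k k
  | skip_seq_skip s g : closed_config (Run s g) -> isSync s ->
      skip_seq_rel (Run (SSeq SSkip s) g) (Run s g).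

Lemma skip_seq_bisimulation : weak_bisimulation home skip_seq_rel.
Proof.
split.
- by move=> _ _ [k ck|s g cs _]; split=> //; apply/closed_seq.
- by move=> g k Rgk; inversion Rgk.
- move=> s0 g0 k0; move E: (Run s0 g0) => k1 R01.
  case: R01 E => [k ck|s g cs s_sync [-> ->]].
  + move=> E; rewrite -E in ck *; exists s0; split=> // Phi p l _.
    split; try by move=> g' /weak_step1.
    * move=> s' g' st; exists s'; first exact: weak_step1.
      (* [closed_config] ignores the heap, so [ck], given at [g0], also serves at [Phi g0]. *)
      by apply: skip_seq_refl; apply: step_closed st ck.
    * move=> s' g' st; exists s'; first exact: weak_step1.
      by apply: skip_seq_refl; apply: step_closed st ck.
  + exists s; split=> // [|Phi p l _].
      by split=> // _; apply: isSync_seql; apply: isSync_skip.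
    split=> [s' g'|s' g' st|g'|g' st].
    * case/step_skip_seq_inv=> -> [-> ->]; exists s; first exact: rt_refl.
      exact: skip_seq_refl.
    * exists s'; last by apply: skip_seq_refl; apply: step_closed st cs.
      by apply: weak_step_prepend (weak_step1 st); apply: step_skip_seq.
    (* Vacuous: a step of [{skip s}] always leaves [s] to run. *)
    * by case/step_skip_seq_inv.
    * by apply: weak_step_prepend (weak_step1 st); apply: step_skip_seq.
Qed.

End SkipSeq.

Theorem mainTheorem17 (n : nat) (home : nat -> 'I_n) (Fld Var : choiceType)
    (s : stmt n Fld Var) (g : gheap n Fld) :
  wf_stmt s -> closed_stmt s -> isSync s ->
  weak_bisimilar home (Run (SSeq SSkip s) g) (Run s g).
Proof.
move=> wfs cs s_sync; exists (skip_seq_rel (n := n) (Fld := Fld) (Var := Var)).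
  exact: skip_seq_bisimulation.
exact: skip_seq_skip.
Qed.
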